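(* Let $g(n)$ be the largest possible number, over all choices of a line $\ell$ and a set $\mathcal{L}$ of $n$ lines in the Euclidean plane, of triangles of unit area among the triangles formed by $\ell$ together with two elements of $\mathcal{L}$. Then $g(n)=\Theta(n^{4/3})$.
   Context: A triangle formed by three lines is the triangle bounded by them (the lines pairwise non-parallel and not concurrent). *)

(* Defs.v *)
From HB Require Import structures.
From mathcomp Require Export all_boot all_order all_algebra.
From mathcomp Require Export all_classical all_reals all_analysis.

Set Implicit Arguments.
Unset Strict Implicit.
Unset Printing Implicit Defensive.

Import Order.TTheory GRing.Theory Num.Theory.
Import numFieldNormedType.Exports.

Local Open Scope classical_set_scope.
Local Open Scope ring_scope.

Section plane.
Variable R : realType.

Definition point : Type := (R * R)%type.

Definition is_line (l : set point) : Prop :=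
  exists a b c : R, (a, b) != (0, 0) /\
    l = [set p : point | a * p.1 + b * p.2 = c].

Definition triangle (p q r : point) : set point :=
  [set x : point | exists s t u : R,
    [/\ [/\ 0 <= s, 0 <= t & 0 <= u], s + t + u = 1,
        x.1 = s * p.1 + t * q.1 + u * r.1 &
        x.2 = s * p.2 + t * q.2 + u * r.2]].

Definition triangle_area (p q r : point) : R :=
  `|(q.1 - p.1) * (r.2 - p.2) - (r.1 - p.1) * (q.2 - p.2)| / 2.

(* Two lines are non-parallel (and distinct) iff they meet in exactly one
   point; three pairwise non-parallel lines are concurrent iff the three
   meeting points coincide, iff two of them do. *)
Definition triangle_vertices (l1 l2 l3 : set point) (p q r : point) : Prop :=
  [/\ l2 `&` l3 = [set p], l3 `&` l1 = [set q], l1 `&` l2 = [set r] & p != q].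

Definition unit_area_triangles (l : set point) (L : set (set point)) :
    set (set point) :=
  [set T | exists l1 l2, [/\ L l1, L l2 &
     exists p q r, [/\ triangle_vertices l l1 l2 p q r,
                       T = triangle p q r & triangle_area p q r = 1]]].

(* If [l] belongs to [L] it contributes nothing, since [l `&` l] is not a
   singleton. *)
Definition attainable_number (n m : nat) : Prop :=
  exists (l : set point) (L : set (set point)),
    [/\ is_line l, L `<=` is_line, (L #= `I_n)%card
      & (unit_area_triangles l L #= `I_m)%card].

Definition is_max_number (n m : nat) : Prop :=
  attainable_number n m /\
  (forall k, attainable_number n k -> (k <= m)%N).

End plane.

(* Main.v *)
Require Import Defs.
From mathcomp Require Import ring lra zify.

Set Implicit Arguments.
Unset Strict Implicit.
Unset Printing Implicit Defensive.

Import Order.TTheory GRing.Theory Num.Theory.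

Local Open Scope ring_scope.

(** Upper bound.  In area-preserving coordinates where [l] is the axis [t = 0],
    a line meeting [l] once reads [s = al * t + be], and two such lines form
    with [l] a triangle of unit area iff
    [al' - al = (be' - be) ^+ 2 / 2] up to exchanging the lines.  Expanding the
    square, this says that the point [(be', al' - be' ^+ 2 / 2)] lies on the
    line [v = - be * u + (al + be ^+ 2 / 2)], so the triangles are bounded by
    the incidences between [n] points and [n] non-vertical lines.

    These are bounded by Szekely's argument: join consecutive points on each
    line.  A non-crossing straight-line graph has at most three times as many
    edges as vertices, since an edge which has neither the largest slope at its
    left end nor the smallest slope at its right end is the first edge below
    some vertex.  Hence [E <= 3 V + cr] for all induced subgraphs, where the number
    [cr] of (ordered) crossings is at most the square of the number of lines,
    and averaging over random vertex subsets of density [1 / q] gives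
    [E * q ^ 2 <= 3 * V * q ^ 3 + cr]; take [q] close to the cube root of [n].

    Lower bound.  Let [be] range over [2K] consecutive integers and [2 al]
    over [5K ^ 2] consecutive integers: of these [10K ^ 3] lines, at least
    [K ^ 4] pairs satisfy [2 al' - 2 al = (be' - be) ^+ 2]. *)

(** * Edge bound for non-crossing straight-line graphs *)

Lemma affine_crossing (R : realFieldType) (a b c d x y : R) :
  x < y -> a * x + b < c * x + d -> c * y + d < a * y + b ->
  exists2 z, x < z < y & a * z + b = c * z + d.
Proof.
move=> xy Hx Hy.
have ac : 0 < a - c.
  have h : 0 < (a - c) * (y - x).
    have -> : (a - c) * (y - x) = (a * y + b - (c * y + d)) + (c * x + d - (a * x + b)) by ring.
    by rewrite addr_gt0 // subr_gt0.
  by rewrite pmulr_lgt0 ?subr_gt0 // in h *; rewrite -subr_gt0 in xy *.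
exists ((d - b) / (a - c)); last by field; rewrite gt_eqF.
by rewrite ltr_pdivlMr // ltr_pdivrMr //; apply/andP; split; lra.
Qed.

Section PlaneGraph.
Variables (R : realFieldType) (V Ed : finType).

(** Edges are graphs of affine functions over open intervals, so each condition compares heights at
    one abscissa; [pg_cross] excludes overlaps as well as crossings. Taking [S] and [D] as sets lets
    subgraphs share the ambient types. *)
Record plane_graph (X Y : V -> R) (lv rv : Ed -> V) (a b : Ed -> R)
    (S : {set V}) (D : {set Ed}) : Prop := PlaneGraph {
  pg_inj : forall u v, X u = X v -> Y u = Y v -> u = v;
  pg_lv : forall e, e \in D -> lv e \in S;
  pg_rv : forall e, e \in D -> rv e \in S;
  pg_lt : forall e, e \in D -> X (lv e) < X (rv e);
  pg_Yl : forall e, e \in D -> Y (lv e) = a e * X (lv e) + b e;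
  pg_Yr : forall e, e \in D -> Y (rv e) = a e * X (rv e) + b e;
  pg_vtx : forall e w, e \in D -> w \in S -> X (lv e) < X w < X (rv e) ->
    Y w <> a e * X w + b e;
  pg_cross : forall e f x, e \in D -> f \in D ->
    X (lv e) < x < X (rv e) -> X (lv f) < x < X (rv f) ->
    a e * x + b e = a f * x + b f -> e = f }.

(** Reflecting the first coordinate exchanges left and right ends, so facts about left ends serve
    for right ends too. *)
Lemma plane_graph_mirror X Y lv rv a b S D :
  plane_graph X Y lv rv a b S D ->
  plane_graph (fun v => - X v) Y rv lv (fun e => - a e) b S D.
Proof.
case=> Hi Hl Hr Hlt HYl HYr Hv Hc; split=> //.
- by move=> u v /oppr_inj; exact: Hi.
- by move=> e /Hlt; rewrite ltrN2.
- by move=> e /HYr ->; rewrite mulrNN.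
- by move=> e /HYl ->; rewrite mulrNN.
- move=> e w eD wS; rewrite !ltrN2 mulrNN => /andP[h1 h2].
  by apply: Hv => //; rewrite h1 h2.
- move=> e f x eD fD /andP[h1 h2] /andP[h3 h4] E.
  apply: (Hc e f (- x)) => //; last by rewrite !mulrN -!mulNr.
    by rewrite ltrNr ltrNl h1 h2.
  by rewrite ltrNr ltrNl h3 h4.
Qed.

(** Edges of a plane graph differ in height at [X w], so a vertex sees at most one of them, and
    charging edges to such vertices is injective. *)
Definition sees_below (X Y : V -> R) (lv rv : Ed -> V) (a b : Ed -> R)
    (D : {set Ed}) (w : V) (e : Ed) : Prop :=
  [/\ X (lv e) < X w < X (rv e), a e * X w + b e < Y w &
   forall f, f \in D -> X (lv f) < X w < X (rv f) ->
     a e * X w + b e < a f * X w + b f -> Y w <= a f * X w + b f].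

Lemma sees_below_mirror X Y lv rv a b D w e :
  sees_below (fun v => - X v) Y rv lv (fun e => - a e) b D w e ->
  sees_below X Y lv rv a b D w e.
Proof.
case; rewrite !ltrN2 !mulrNN => /andP[h1 h2] h3 h4; split=> //.
  by rewrite h1 h2.
by move=> f fD /andP[h5 h6]; have := h4 f fD; rewrite !ltrN2 mulrNN h5 h6; apply.
Qed.

Section Charging.
Variables (X Y : V -> R) (lv rv : Ed -> V) (a b : Ed -> R).
Variables (S : {set V}) (D : {set Ed}).
Hypothesis G : plane_graph X Y lv rv a b S D.
Let h e x := a e * x + b e.

(** Edges that exchange their order meet strictly between [x] and [y]; the closed bounds let the
    comparison start or end at a vertex. *)
Lemma edges_no_switch e f x y : e \in D -> f \in D -> x < y ->
  X (lv e) <= x -> y <= X (rv e) -> X (lv f) <= x -> y <= X (rv f) ->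
  h e x < h f x -> h e y <= h f y.
Proof.
move=> eD fD xy e1 e2 f1 f2 hx; rewrite leNgt; apply/negP => hy.
have [z /andP[xz zy] E] := affine_crossing xy hx hy.
have ef : e = f.
  apply: (pg_cross G eD fD _ _ E).
    by rewrite (le_lt_trans e1 xz) (lt_le_trans zy e2).
  by rewrite (le_lt_trans f1 xz) (lt_le_trans zy f2).
by move: hx; rewrite ef ltxx.
Qed.

(* The vertex is the leftmost one in the wedge between [e] and the next
   edge [f] above it at their common left end. *)
Lemma wedge_witness e f : e \in D -> f \in D -> lv f = lv e -> a e < a f ->
  X (rv f) < X (rv e) ->
  (forall g, g \in D -> lv g = lv e -> a e < a g -> a f <= a g) ->
  exists2 w, w \in S & sees_below X Y lv rv a b D w e.
Proof.
move=> eD fD lfe aef rfe fmin; set u := lv e.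
have hu g : g \in D -> lv g = u -> h g (X u) = Y u.
  by move=> gD gu; rewrite -gu (pg_Yl G gD).
have hgt g k x : g \in D -> k \in D -> lv g = u -> lv k = u -> X u < x ->
    (h g x < h k x) = (a g < a k).
  move=> gD kD gu ku ux.
  have E : h k x - h g x = (a k - a g) * (x - X u).
    have := hu _ gD gu; have := hu _ kD ku; rewrite /h => E1 E2.
    have E3 : a k * X u + b k = a g * X u + b g by rewrite E1 E2.
    have -> : b k = a g * X u + b g - a k * X u by rewrite -E3; ring.
    by ring.
  by rewrite -subr_gt0 E pmulr_lgt0 ?subr_gt0.
have ufr : X u < X (rv f) by rewrite /u -lfe (pg_lt G fD).
pose P w := [&& w \in S, X u < X w, X w <= X (rv f), h e (X w) < Y w & Y w <= h f (X w)].
have P0 : P (rv f).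
  by rewrite /P (pg_rv G fD) ufr lexx (pg_Yr G fD) lexx (hgt e f) // aef.
case: (@arg_minP _ _ _ (rv f) P X P0) => w /and5P[wS uw wf ew fw] wmin.
have we : X w < X (rv e) by exact: le_lt_trans rfe.
exists w => //; split=> //; first by rewrite uw we.
move=> g gD /andP[gw1 gw2] egw; rewrite leNgt; apply/negP => ggw.
have gf : h g (X w) < h f (X w) by exact: lt_le_trans fw.
(* If [g] starts to the right of [u], its left end lies in the wedge and left of [w], against
   minimality. *)
have [uy|yu] := ltP (X u) (X (lv g)).
- have Yg := pg_Yl G gD.
  have : P (lv g).
    apply/and5P; split=> //; first exact: (pg_lv G gD).
    + exact: le_trans (ltW gw1) wf.
    + rewrite lt_neqAle; apply/andP; split.
        apply/eqP => E; apply: (pg_vtx G eD (pg_lv G gD)) => //.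
        by rewrite uy (lt_trans gw1).
      rewrite leNgt; apply/negP; rewrite Yg => lt.
      have := edges_no_switch gD eD gw1 (lexx _) (ltW gw2) (ltW uy) (ltW we) lt.
      by rewrite leNgt egw.
    + rewrite leNgt; apply/negP; rewrite Yg => lt.
      have := edges_no_switch fD gD gw1 _ wf (lexx _) (ltW gw2) lt.
      by rewrite lfe => /(_ (ltW uy)); rewrite leNgt gf.
  by move=> /wmin; rewrite leNgt gw1.
(* Otherwise [g] reaches back to the abscissa of [u]: below [u] it would have to cross [e], above
   [u] to cross [f], and at [u] it either starts with a slope strictly between theirs or runs
   through the vertex [u]. *)
have [lt|gt|eq] := ltgtP (h g (X u)) (Y u).
- rewrite -(hu e) // in lt.
  by have := edges_no_switch gD eD uw yu (ltW gw2) (lexx _) (ltW we) lt; rewrite leNgt egw.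
- rewrite -(hu f) // in gt.
  have := edges_no_switch fD gD uw _ wf yu (ltW gw2) gt.
  by rewrite lfe => /(_ (lexx _)); rewrite leNgt gf.
move: yu; rewrite le_eqVlt => /orP[/eqP yu'|yu'].
- have gu : lv g = u.
    by apply: (pg_inj G) => //; rewrite -eq -yu'; apply: (pg_Yl G gD).
  have aeg : a e < a g by rewrite -(hgt e g (X w)).
  have := fmin g gD gu aeg.
  by rewrite leNgt -(hgt g f (X w)) // gf.
- apply: (pg_vtx G gD (pg_lv G eD)) (esym eq).
  by rewrite yu' (lt_trans uw gw2).
Qed.

Lemma edge_eq_of_lv_slope e f :
  e \in D -> f \in D -> lv e = lv f -> a e = a f -> e = f.
Proof.
move=> eD fD ef aef; pose x := (X (lv e) + Num.min (X (rv e)) (X (rv f))) / 2.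
have : X (lv e) < Num.min (X (rv e)) (X (rv f)).
  by rewrite lt_min (pg_lt G eD) ef (pg_lt G fD).
move=> lem; have := midf_lt lem; rewrite -/x lt_min => -[h1 /andP[h2 h3]].
apply: (pg_cross G eD fD (x := x)); rewrite -?ef ?h1 ?h2 ?h3 //.
have := pg_Yl G eD; have := pg_Yl G fD; rewrite -ef -aef => -> /addrI ->.
by [].
Qed.

End Charging.

Lemma next_edge_above X Y lv rv a b S D e :
  plane_graph X Y lv rv a b S D -> e \in D ->
  ~~ [forall f in D, (lv f == lv e) ==> (a f <= a e)] ->
  exists f, [/\ f \in D, lv f = lv e, a e < a f &
    X (rv f) < X (rv e) -> exists2 w, w \in S & sees_below X Y lv rv a b D w e].
Proof.
move=> G eD /forall_inPn[f fD]; rewrite negb_imply -ltNge => /andP[/eqP lf af].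
pose P g := [&& g \in D, lv g == lv e & a e < a g].
have P0 : P f by rewrite /P fD lf eqxx af.
case: (@arg_minP _ _ _ f P a P0) => g /and3P[gD /eqP lg ag] gmin.
exists g; split=> // rge; apply: (wedge_witness G eD gD) => // k kD lk ak.
by apply: gmin; rewrite /P kD lk eqxx ak.
Qed.

(** Take the next edges [f] and [g] above [e] at its left and right ends. If [f] stops before [e]
    does, or [g] starts after [e] does, a wedge gives the vertex; otherwise [f] and [g] both span
    [e] and must cross. *)
Lemma nonextremal_edge_seen X Y lv rv a b S D e :
  plane_graph X Y lv rv a b S D -> e \in D ->
  ~~ [forall f in D, (lv f == lv e) ==> (a f <= a e)] ->
  ~~ [forall f in D, (rv f == rv e) ==> (a e <= a f)] ->
  exists2 w, w \in S & sees_below X Y lv rv a b D w e.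
Proof.
move=> G eD n1 n2; have G' := plane_graph_mirror G.
have [f [fD lf af Hf]] := next_edge_above G eD n1.
have n2' : ~~ [forall f in D, (rv f == rv e) ==> (- a f <= - a e)].
  by under eq_forallb do rewrite lerN2.
have [g [gD rg ag Hg]] := next_edge_above G' eD n2'.
have [/Hf//|ef] := ltP (X (rv f)) (X (rv e)).
have [lt|ge] := ltP (X (lv e)) (X (lv g)).
  by case: Hg => [|w wS sw]; [rewrite ltrN2|exists w; last exact: sees_below_mirror].
rewrite ltrN2 in ag; have lte := pg_lt G eD.
have h1 : a f * X (lv e) + b f < a g * X (lv e) + b g.
  rewrite -{1}lf -(pg_Yl G fD) lf (pg_Yl G eD).
  have := pg_Yr G eD; have := pg_Yr G gD; rewrite rg => -> E.
  have : 0 < (a e - a g) * (X (rv e) - X (lv e)) by rewrite mulr_gt0 // subr_gt0.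
  by lra.
have := edges_no_switch G fD gD lte _ ef ge _ h1.
rewrite lf rg => /(_ (lexx _) (lexx _)).
rewrite -{2}rg -(pg_Yr G gD) rg (pg_Yr G eD) leNgt => /negP[].
have := pg_Yl G eD; have := pg_Yl G fD; rewrite lf => -> E.
have : 0 < (a f - a e) * (X (rv e) - X (lv e)) by rewrite mulr_gt0 // subr_gt0.
by lra.
Qed.

Lemma leq_card_injin (T U : finType) (f : T -> U) (A : {set T}) (B : {set U}) :
  {in A, forall x, f x \in B} -> {in A &, injective f} -> (#|A| <= #|B|)%N.
Proof.
move=> fAB finj; rewrite -(card_in_imset finj); apply: subset_leq_card.
by apply/fintype.subsetP => _ /imsetP[x xA ->]; exact: fAB.
Qed.

(** An edge of [D1] is determined by its left end, one of [D2] by its right end, and one of [D3] by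
    a vertex that sees it. *)
Lemma plane_graph_card X Y lv rv a b S D :
  plane_graph X Y lv rv a b S D -> (#|D| <= 3 * #|S|)%N.
Proof.
move=> G; have G' := plane_graph_mirror G.
pose D1 := [set e in D | [forall f in D, (lv f == lv e) ==> (a f <= a e)]]%SET.
pose D2 := [set e in D | [forall f in D, (rv f == rv e) ==> (a e <= a f)]]%SET.
pose D3 := D :\: (D1 :|: D2).
have c1 : (#|D1| <= #|S|)%N.
  apply: (leq_card_injin (f := lv)) => [e|e f].
    by rewrite inE => /andP[eD _]; exact: (pg_lv G eD).
  rewrite !inE => /andP[eD /forall_inP he] /andP[fD /forall_inP hf] ef.
  apply: (edge_eq_of_lv_slope G eD fD ef); apply/eqP; rewrite eq_le.
  have := he f fD; have := hf e eD; rewrite ef eqxx /= => -> ->.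
  by [].
have c2 : (#|D2| <= #|S|)%N.
  apply: (leq_card_injin (f := rv)) => [e|e f].
    by rewrite inE => /andP[eD _]; exact: (pg_rv G eD).
  rewrite !inE => /andP[eD /forall_inP he] /andP[fD /forall_inP hf] ef.
  apply: (edge_eq_of_lv_slope G' eD fD ef); congr (- _); apply/eqP; rewrite eq_le.
  have := he f fD; have := hf e eD; rewrite ef eqxx /= => -> ->.
  by [].
have D3D e : e \in D3 -> e \in D by rewrite inE => /andP[].
have c3 : (#|D3| <= #|S|)%N.
  have /choice[w Hw] : forall e, exists w,
      e \in D3 -> w \in S /\ sees_below X Y lv rv a b D w e.
    move=> e; case: (boolP (e \in D3)) => [e3|_]; last by exists (lv e).
    have := e3; rewrite !inE negb_or => /andP[/andP[+ +] eD].
    rewrite eD /= => n1 n2.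
    by have [w wS sw] := nonextremal_edge_seen G eD n1 n2; exists w.
  apply: (leq_card_injin (f := w)) => [e /Hw[]//|e f e3 f3 ef].
  have [_ [he1 he2 he3]] := Hw _ e3; have [_ [hf1 hf2 hf3]] := Hw _ f3.
  rewrite -ef in hf1 hf2 hf3; have [eD fD] := (D3D _ e3, D3D _ f3).
  have [lt|gt|eq] := ltgtP (a e * X (w e) + b e) (a f * X (w e) + b f).
  - by have := he3 f fD hf1 lt; rewrite leNgt hf2.
  - by have := hf3 e eD he1 gt; rewrite leNgt he2.
  - exact: (pg_cross G eD fD he1 hf1 eq).
have sD : D \subset D1 :|: D2 :|: D3.
  by apply/fintype.subsetP => e eD; rewrite !inE eD /= andbT orbN.
have := subset_leq_card sD; move: (cardsU (D1 :|: D2) D3) (cardsU D1 D2).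
lia.
Qed.

End PlaneGraph.

(** * Averaging over random vertex subsets *)

Section Sampling.
Variables (V : finType) (q : nat).

Definition zeros (phi : {ffun V -> 'I_q.+1}) : {set V} :=
  [set v | phi v == ord0]%SET.

Lemma card_zeros_supset (T : {set V}) :
  (#|[set phi | T \subset zeros phi]%SET| * q.+1 ^ #|T| = q.+1 ^ #|V|)%N.
Proof.
have -> : #|[set phi | T \subset zeros phi]%SET| =
          #|pffun_on (@ord0 q) (~: T) (predT : {pred 'I_q.+1})|.
  rewrite cardsE; apply: eq_card => phi; rewrite !inE.
  apply/idP/pffun_onP => [/fintype.subsetP Ts|[/fintype.subsetP Ts _]].
    split=> //; apply/fintype.subsetP => v; rewrite inE => h; rewrite inE.
    by apply: contra h => /Ts; rewrite inE.
  apply/fintype.subsetP => v vT; rewrite inE; apply: contraLR vT => h.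
  by have := Ts v h; rewrite inE.
by rewrite card_pffun_on card_ord -expnD addnC cardsC.
Qed.

(** Linearity of expectation with denominators cleared: exchange the sums and count, for each [i],
    the functions vanishing on [t i]. *)
Lemma sum_card_zeros_supset (I : finType) (A : {set I}) (t : I -> {set V}) k :
  {in A, forall i, #|t i| = k} ->
  ((\sum_phi #|[set i in A | t i \subset zeros phi]%SET|) * q.+1 ^ k =
   #|A| * q.+1 ^ #|V|)%N.
Proof.
move=> tk.
have -> : (\sum_phi #|[set i in A | t i \subset zeros phi]%SET| =
    \sum_(i in A) #|[set phi | t i \subset zeros phi]%SET|)%N.
  transitivity (\sum_phi \sum_(i in A) (t i \subset zeros phi : nat))%N.
    apply: eq_bigr => phi _; rewrite -sum1_card.
    rewrite (eq_bigl (fun i => (i \in A) && (t i \subset zeros phi))).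
      by rewrite big_mkcondr; apply: eq_bigr => i _; case: ifP.
    by move=> i; rewrite inE.
  rewrite exchange_big; apply: eq_bigr => i _.
  rewrite -sum1_card [RHS]big_mkcond; apply: eq_bigr => phi _.
  by rewrite inE; case: (_ \subset _).
rewrite big_distrl /= -sum_nat_const; apply: eq_bigr => i iA.
by rewrite -(card_zeros_supset (t i)) tk.
Qed.

(* Averages the hypothesis over the zero set of a uniformly random
   [phi : V -> 'I_q.+1], which contains a given k-set with probability
   [q.+1 ^ - k]. *)
Lemma sampling_bound (I J : finType) (A : {set I}) (B : {set J})
    (t : I -> {set V}) (s : J -> {set V}) c :
  {in A, forall i, #|t i| = 2} -> {in B, forall j, #|s j| = 4} ->
  (forall S : {set V}, #|[set i in A | t i \subset S]%SET| <=
     c * #|S| + #|[set j in B | s j \subset S]%SET|)%N ->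
  (#|A| * q.+1 ^ 2 <= c * #|V| * q.+1 ^ 3 + #|B|)%N.
Proof.
move=> t2 s4 H.
have HS : (\sum_phi #|[set i in A | t i \subset zeros phi]%SET| <=
    c * \sum_phi #|zeros phi| + \sum_phi #|[set j in B | s j \subset zeros phi]%SET|)%N.
  by rewrite big_distrr -big_split; apply: leq_sum => phi _; exact: H.
have E1 := sum_card_zeros_supset t2; have E2 := sum_card_zeros_supset s4.
have : ((\sum_phi #|zeros phi|) * q.+1 ^ 1 = #|V| * q.+1 ^ #|V|)%N.
  have c1 : {in [set: V]%SET, forall v, #|[set v]%SET| = 1%N}.
    by move=> v _; rewrite cards1.
  have := sum_card_zeros_supset c1; rewrite cardsT => <-; congr muln.
  apply: eq_bigr => phi _; apply: eq_card => v.
  by rewrite !inE finset.sub1set inE.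
move: HS E1 E2; set a := (\sum_phi _)%N; set b := (\sum_phi _)%N; set d := (\sum_phi _)%N.
move=> HS E1 E2 E3; have Q0 : (0 < q.+1 ^ #|V|)%N by rewrite expn_gt0.
(* Each term now becomes one of the three sums times [q.+1 ^ 4]. *)
rewrite -(leq_pmul2r Q0) mulnDl -E2.
have -> : (#|A| * q.+1 ^ 2 * q.+1 ^ #|V| = a * q.+1 ^ 4)%N.
  by rewrite mulnAC -E1 -mulnA -expnD.
have -> : (c * #|V| * q.+1 ^ 3 * q.+1 ^ #|V| = c * b * q.+1 ^ 4)%N.
  by rewrite mulnAC -(mulnA c) -E3 -!mulnA -expnD.
by rewrite -mulnDl leq_mul2r HS orbT.
Qed.

End Sampling.

(** * Point-line incidences by counting crossings *)

Section Incidences.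
Variables (R : realFieldType) (V W : finType) (X Y : V -> R) (A B : W -> R).
Hypothesis points_inj : forall u v, X u = X v -> Y u = Y v -> u = v.
Hypothesis lines_inj : forall l m, A l = A m -> B l = B m -> l = m.

Definition inc v l := Y v == A l * X v + B l.
Definition incidences : {set V * W} := [set p | inc p.1 p.2]%SET.

Let Ed := (W * V * V)%type.
Let lv (e : Ed) := e.1.2.
Let rv (e : Ed) := e.2.
Let ln (e : Ed) := e.1.1.

Definition consecutive : {set W * V * V} :=
  [set e | [&& inc (lv e) (ln e), inc (rv e) (ln e), X (lv e) < X (rv e) &
   [forall w, inc w (ln e) ==> ~~ (X (lv e) < X w < X (rv e))]]]%SET.
Let D := consecutive.

Lemma inc_eqX u v l : inc u l -> inc v l -> X u = X v -> u = v.
Proof. by move=> /eqP hu /eqP hv E; apply: points_inj => //; rewrite hu hv E. Qed.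

Lemma lines_meet_once l m x y : A l * x + B l = A m * x + B m ->
  A l * y + B l = A m * y + B m -> x <> y -> l = m.
Proof.
move=> Ex Ey /eqP xy.
have : (A l - A m) * (x - y) = 0.
  have -> : (A l - A m) * (x - y) =
    (A l * x + B l) - (A l * y + B l) - ((A m * x + B m) - (A m * y + B m)) by ring.
  by rewrite Ex Ey subrr.
move/eqP; rewrite mulf_eq0 [x - y == 0]subr_eq0 (negbTE xy) orbF subr_eq0 => /eqP E.
by apply: lines_inj => //; move: Ex; rewrite E => /addrI.
Qed.

Lemma consecutive_unique e f x : e \in D -> f \in D -> ln e = ln f ->
  X (lv e) < x < X (rv e) -> X (lv f) < x < X (rv f) -> e = f.
Proof.
rewrite !inE => /and4P[el er _ /forallP en] /and4P[fl fr _ /forallP fn] ef.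
move=> /andP[e1 e2] /andP[f1 f2]; rewrite -ef in fl fr fn.
have E1 : lv e = lv f.
  apply: (inc_eqX el fl).
  have := implyP (en (lv f)) fl; have := implyP (fn (lv e)) el.
  rewrite (lt_trans e1 f2) (lt_trans f1 e2) !andbT -!leNgt => h1 h2.
  by apply/eqP; rewrite eq_le h1 h2.
have E2 : rv e = rv f.
  apply: (inc_eqX er fr).
  have := implyP (en (rv f)) fr; have := implyP (fn (rv e)) er.
  rewrite (lt_trans e1 f2) (lt_trans f1 e2) /= -!leNgt => h1 h2.
  by apply/eqP; rewrite eq_le h1 h2.
case: e f ef E1 E2 {el er en fl fr fn e1 e2 f1 f2} => [[? ?] ?] [[? ?] ?].
by rewrite /ln /lv /rv /= => -> -> ->.
Qed.

(** Ordered pairs count each crossing twice, which costs only a constant and allows a direct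
    injection into [W * W]. *)
Definition crossings : {set (W * V * V) * (W * V * V)} :=
  [set p | [&& p.1 \in D, p.2 \in D, p.1 != p.2 & `[< exists x,
    [/\ X (lv p.1) < x < X (rv p.1), X (lv p.2) < x < X (rv p.2) &
     A (ln p.1) * x + B (ln p.1) = A (ln p.2) * x + B (ln p.2)] >]]]%SET.

Lemma crossingP e f : reflect
  [/\ e \in D, f \in D, e <> f & exists x, [/\ X (lv e) < x < X (rv e),
    X (lv f) < x < X (rv f) & A (ln e) * x + B (ln e) = A (ln f) * x + B (ln f)]]
  ((e, f) \in crossings).
Proof.
apply: (iffP idP) => [K|[eD fD /eqP ef K]].
  by rewrite inE in K; case/and4P: K => -> -> /eqP ? /asboolP.
by rewrite inE /= eD fD ef; exact/asboolP.
Qed.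

Lemma crossing_ln e f : (e, f) \in crossings -> ln e <> ln f.
Proof.
move=> /crossingP[eD fD ef [x [h1 h2 _]]] E; apply: ef.
exact: consecutive_unique E h1 h2.
Qed.

(** Distinct lines meet at most once, and a point lies inside at most one edge of each line, so a
    crossing is determined by its pair of lines. *)
Lemma card_crossings : (#|crossings| <= #|W| ^ 2)%N.
Proof.
rewrite -mulnn -card_prod -cardsT.
apply: (leq_card_injin (f := fun p : Ed * Ed => (ln p.1, ln p.2))) => [p _|].
  by rewrite inE.
move=> [e f] [e' f'] K K' [Ee Ef]; have nE := crossing_ln K.
move: K K' => /crossingP[eD fD _ [x [h1 h2 h3]]].
move=> /crossingP[eD' fD' _ [x' [h1' h2' h3']]].
have xx' : x = x'.
  apply/eqP/negP => /negP/eqP xx'; apply: nE; apply: lines_meet_once h3 _ xx'.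
  by rewrite Ee Ef.
rewrite -xx' in h1' h2'; congr pair.
  exact: consecutive_unique Ee h1 h1'.
exact: consecutive_unique Ef h2 h2'.
Qed.

Definition ends (e : W * V * V) : {set V} := [set lv e; rv e]%SET.

Lemma consecutive_inc e v : e \in D -> v \in ends e -> inc v (ln e).
Proof. by rewrite !inE => /and4P[h1 h2 _ _] /orP[] /eqP ->. Qed.

Lemma card_ends e : e \in D -> #|ends e| = 2%N.
Proof.
rewrite inE => /and4P[_ _ h _]; rewrite cards2.
by case: eqP h => // ->; rewrite ltxx.
Qed.

(** A common end would be a second meeting point of two distinct lines. Four distinct ends make a
    crossing survive sampling with probability [q.+1 ^ - 4]. *)
Lemma card_crossing_ends e f : (e, f) \in crossings -> #|ends e :|: ends f| = 4%N.
Proof.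
move=> K; have nE := crossing_ln K.
move: K => /crossingP[eD fD _ [x [h1 h2 h3]]].
rewrite cardsU !card_ends // (_ : ends e :&: ends f = finset.set0) ?cards0 //.
apply/setP => v; rewrite [RHS]inE; apply/negP; rewrite inE => /andP[ve vf].
apply: nE; apply: (lines_meet_once h3 (y := X v)).
  by rewrite -(eqP (consecutive_inc eD ve)) -(eqP (consecutive_inc fD vf)).
move=> xv; move: ve h1; rewrite xv !inE => /orP[]/eqP ->; by rewrite ltxx ?andbF.
Qed.

(** Deleting the first edge of every crossing in the induced graph leaves a plane graph, and each
    crossing deletes at most one edge. *)
Lemma crossing_lower_bound (S : {set V}) :
  (#|[set e in D | ends e \subset S]%SET| <=
   3 * #|S| + #|[set p in crossings | ends p.1 :|: ends p.2 \subset S]%SET|)%N.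
Proof.
set DS := [set e in D | _]%SET; set K := [set p in crossings | _]%SET.
pose D' := DS :\: [set p.1 | p in K]%SET.
have D'D e : e \in D' -> e \in D by rewrite !inE => /andP[_ /andP[]].
have D'S e : e \in D' -> ends e \subset S by rewrite !inE => /andP[_ /andP[]].
have De e : e \in D' -> [/\ lv e \in S, rv e \in S, X (lv e) < X (rv e),
    inc (lv e) (ln e) & inc (rv e) (ln e)].
  move=> e'; have := D'D e e'; rewrite inE => /and4P[-> -> -> _].
  have /fintype.subsetP sS := D'S e e'.
  by split=> //; apply: sS; rewrite !inE eqxx ?orbT.
have G : plane_graph X Y lv rv (fun e => A (ln e)) (fun e => B (ln e)) S D'.
  split=> //; try by move=> e /De[].
  - by move=> e /De[_ _ _ /eqP].
  - by move=> e /De[_ _ _ _ /eqP].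
  - move=> e w /D'D; rewrite inE => /and4P[_ _ _ /forallP/(_ w) h] _ lt /eqP E.
    by move: h; rewrite /inc E lt.
  - move=> e f x e' f' xe xf E; apply: contrapT => ef.
    have : (e, f) \in K.
      rewrite inE; apply/andP; split; last by rewrite /= finset.subUset !D'S.
      by apply/crossingP; split=> //; [exact: D'D|exact: D'D|exists x].
    by move: e'; rewrite inE => /andP[/negP h _] K1; apply: h; apply/imsetP; exists (e, f).
have sD : DS \subset D' :|: [set p.1 | p in K]%SET.
  by apply/fintype.subsetP => e eD; rewrite finset.in_setU finset.in_setD eD andbT orNb.
apply: leq_trans (subset_leq_card sD) (leq_trans (leq_card_setU _ _) _).
exact: leq_add (plane_graph_card G) (leq_imset_card _ _).
Qed.

Lemma card_consecutive q :
  (#|consecutive| * q.+1 ^ 2 <= 3 * #|V| * q.+1 ^ 3 + #|W| ^ 2)%N.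
Proof.
have K4 : {in crossings, forall p, #|ends p.1 :|: ends p.2| = 4%N}.
  by case=> e f; exact: card_crossing_ends.
apply: leq_trans (sampling_bound q card_ends K4 crossing_lower_bound) _.
by rewrite leq_add2l card_crossings.
Qed.

(** Apart from the leftmost point on each line, every incident point is the right end of a
    consecutive pair. *)
Lemma card_incidences_le : (#|incidences| <= #|W| + #|consecutive|)%N.
Proof.
pose M := [set p : V * W | inc p.1 p.2 & [forall w, inc w p.2 ==> (X p.1 <= X w)]]%SET.
have cM : (#|M| <= #|W|)%N.
  rewrite -cardsT; apply: (leq_card_injin (f := snd)) => [p _|].
    by rewrite inE.
  case=> u l [v m]; rewrite !inE /= => /andP[ul /forallP hu] /andP[vm /forallP hv] lm.
  rewrite -lm in vm hv *; congr pair; apply: (inc_eqX ul vm).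
  by apply/eqP; rewrite eq_le (implyP (hu v)) // (implyP (hv u)).
have sI : incidences \subset M :|: [set (rv e, ln e) | e in D]%SET.
  apply/fintype.subsetP => -[v l] vl; rewrite inE orbC -implyNb; apply/implyP => nI.
  move: vl; rewrite !inE /= => vl; rewrite vl /=; apply/forallP => w.
  apply/implyP => wl; rewrite leNgt; apply: contra nI => wv.
  pose P u := inc u l && (X u < X v).
  have P0 : P w by rewrite /P wl wv.
  case: (@arg_maxP _ _ _ w P X P0) => u /andP[ul uv] umax.
  apply/imsetP; exists (l, u, v) => //; rewrite inE /= ul vl uv; apply/forallP => z.
  apply/implyP => zl; apply/negP => /andP[uz zv].
  have : X z <= X u by apply: umax; rewrite /P zl zv.
  by rewrite leNgt uz.
apply: leq_trans (subset_leq_card sI) (leq_trans (leq_card_setU _ _) _).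
exact: leq_add cM (leq_imset_card _ _).
Qed.

Lemma szemeredi_trotter q :
  (#|incidences| * q.+1 ^ 2 <= #|W| * q.+1 ^ 2 + 3 * #|V| * q.+1 ^ 3 + #|W| ^ 2)%N.
Proof.
apply: leq_trans (leq_mul card_incidences_le (leqnn _)) _.
by rewrite mulnDl -addnA leq_add2l card_consecutive.
Qed.

End Incidences.

Local Open Scope classical_set_scope.

(** * Upper bound: unit-area triangles as incidences *)

Lemma subset_image_finset_card (T : Type) (J : finType) (B : {set J})
    (f : J -> T) (A : set T) :
  A `<=` f @` [set x | x \in B] -> exists2 m, (m <= #|B|)%N & (A #= `I_m)%card.
Proof.
move=> AB; have AI : (A #<= `I_#|B|)%card.
  apply: card_le_trans (subset_card_le AB) (card_le_trans (card_image_le _ _) _).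
  have inj : {in [set x | x \in B] &, injective (fun x => index x (enum B))}.
    move=> x y; rewrite !inE => xB yB E.
    have h z : z \in B -> nth x (enum B) (index z (enum B)) = z.
      by move=> zB; rewrite nth_index // mem_enum.
    by have := h x xB; rewrite E h.
  rewrite -(card_le_eql (inj_card_eq inj)); apply: subset_card_le => _ [x xB <-] /=.
  by rewrite cardE index_mem mem_enum.
have /finite_setP[m Am] : finite_set A by exact/(card_le_finite AI)/finite_II.
by exists m => //; rewrite -card_le_II -(card_le_eql Am).
Qed.

Section Coordinates.
Variables (R : realType) (a b c : R).
Hypothesis ab : (a, b) != (0, 0).

(* [(sc p, tc p)] are area-preserving affine coordinates in which the line
   [a * x + b * y = c] becomes [tc = 0]. *)
Definition sc (p : point R) := (a * p.2 - b * p.1) / (a ^+ 2 + b ^+ 2).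
Definition tc (p : point R) := a * p.1 + b * p.2 - c.
Definition slanted (k : R * R) : set (point R) := [set p | sc p = k.1 * tc p + k.2].

Lemma normal_sqr_gt0 : 0 < a ^+ 2 + b ^+ 2.
Proof.
rewrite lt0r addr_ge0 ?sqr_ge0 // andbT paddr_eq0 ?sqr_ge0 // !sqrf_eq0.
by apply: contra ab => /andP[/eqP -> /eqP ->].
Qed.

Lemma slanted_of_meet (l : set (point R)) (q : point R) : is_line l ->
  l `&` [set p : point R | a * p.1 + b * p.2 = c] = [set q] ->
  exists k, l = slanted k.
Proof.
move=> [a' [b' [c' [ab' ->]]]] E; have d0 := normal_sqr_gt0.
have [/= q1 q2] : ([set p : point R | a' * p.1 + b' * p.2 = c'] `&`
    [set p : point R | a * p.1 + b * p.2 = c]) q by rewrite E.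
(* If the normals were parallel, moving [q] by [(- b, a)] would give a second common point. *)
have D0 : a * b' - b * a' != 0.
  apply/eqP => D0.
  have : ([set p : point R | a' * p.1 + b' * p.2 = c'] `&`
     [set p : point R | a * p.1 + b * p.2 = c]) (q.1 - b, q.2 + a).
    by split=> /=; [rewrite -q1|rewrite -q2]; lra.
  rewrite E => /= -[qq]; have := qq; case: (q) => x y /= [h1 h2].
  by move: ab; rewrite (_ : a = 0) 1?(_ : b = 0) ?eqxx //; lra.
exists (- (a' * a + b' * b) / ((a ^+ 2 + b ^+ 2) * (a * b' - b * a')),
  (c' - (a' * a + b' * b) * c / (a ^+ 2 + b ^+ 2)) / (a * b' - b * a')).
apply/seteqP; split=> p /=; rewrite /slanted /sc /tc /= => h.
  rewrite -h; field; by rewrite D0 gt_eqF.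
have -> : a' * p.1 + b' * p.2 = c' + (a * b' - b * a') *
  ((a * p.2 - b * p.1) / (a ^+ 2 + b ^+ 2) -
   (- (a' * a + b' * b) / ((a ^+ 2 + b ^+ 2) * (a * b' - b * a')) *
    (a * p.1 + b * p.2 - c) + (c' - (a' * a + b' * b) * c / (a ^+ 2 + b ^+ 2)) / (a * b' - b * a'))).
  by field; rewrite D0 gt_eqF.
by rewrite h subrr mulr0 addr0.
Qed.

(** The base on the axis joins the feet [k1.2] and [k2.2], and the signed height satisfies
    [tc p * (k1.1 - k2.1) = k2.2 - k1.2]. Eliminating [tc p] from the area equation leaves two
    signs. *)
Lemma unit_area_slanted (k1 k2 : R * R) (p q r : point R) :
  triangle_vertices [set p : point R | a * p.1 + b * p.2 = c]
    (slanted k1) (slanted k2) p q r -> triangle_area p q r = 1 ->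
  k1.1 - k2.1 = (k2.2 - k1.2) ^+ 2 / 2 \/ k2.1 - k1.1 = (k2.2 - k1.2) ^+ 2 / 2.
Proof.
move=> [Ep Eq Er _] ar; have d0 := normal_sqr_gt0.
have [p1 p2] : (slanted k1 `&` slanted k2) p by rewrite Ep.
have [q1 q2] : (slanted k2 `&` [set p : point R | a * p.1 + b * p.2 = c]) q by rewrite Eq.
have [r2 r1] : ([set p : point R | a * p.1 + b * p.2 = c] `&` slanted k1) r by rewrite Er.
have tq : tc q = 0 by rewrite /tc q2 subrr.
have tr : tc r = 0 by rewrite /tc r2 subrr.
have sq : sc q = k2.2 by rewrite q1 tq mulr0 add0r.
have sr : sc r = k1.2 by rewrite r1 tr mulr0 add0r.
have D : (q.1 - p.1) * (r.2 - p.2) - (r.1 - p.1) * (q.2 - p.2) =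
   (sc r - sc p) * (tc q - tc p) - (sc q - sc p) * (tc r - tc p).
  by rewrite /sc /tc; field; rewrite gt_eqF.
rewrite /slanted /= in p1 p2.
have {}D : (q.1 - p.1) * (r.2 - p.2) - (r.1 - p.1) * (q.2 - p.2) = tc p * (k2.2 - k1.2).
  by rewrite D tq tr sq sr; ring.
have E : tc p * (k1.1 - k2.1) = k2.2 - k1.2 by lra.
have E2 : (k2.2 - k1.2) ^+ 2 = (tc p * (k2.2 - k1.2)) * (k1.1 - k2.1).
  by rewrite expr2 -{1}E; ring.
have : `|tc p * (k2.2 - k1.2)| = 2 by move: ar; rewrite /triangle_area D; lra.
by move/eqP; rewrite eqr_norml => /andP[/orP[]/eqP m _];
  rewrite m in E2; [left|right]; rewrite E2; lra.
Qed.

End Coordinates.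

Lemma unit_area_triangles_card (R : realType) (l : set (point R))
    (L : set (set (point R))) n q :
  is_line l -> L `<=` @is_line R -> (L #= `I_n)%card ->
  exists2 m, (m * q.+1 ^ 2 <= 2 * (n * q.+1 ^ 2 + 3 * n * q.+1 ^ 3 + n ^ 2))%N &
    (unit_area_triangles l L #= `I_m)%card.
Proof.
move=> [a [b [c [ab ->]]]] Lline; set l0 := [set p : point R | _].
rewrite card_eq_sym => /card_set_bijP[f [fL finj fsurj]].
(* Lines without a slanted form do not meet [l0] in a single point, so they form no triangle with
   it. *)
pose T := {i : 'I_n | `[< exists k, f i = slanted a b c k >]}.
have /choice[k fk] : forall i : T, exists k, f (val i) = slanted a b c k.
  by case=> i /= /asboolP.
have kinj i j : k i = k j -> i = j.
  move=> kij; have fij : f (val i) = f (val j) by rewrite !fk kij.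
  by apply/val_inj/val_inj/(finj _ _ _ _ fij); rewrite inE; exact: ltn_ord.
(* With [k i = (al, be)] and [k j = (al', be')], the incidence [Y i = A j * X i + B j] unfolds to
   [al - al' = (be - be') ^+ 2 / 2]. *)
pose X i := (k i).2; pose Y i := (k i).1 - (k i).2 ^+ 2 / 2.
pose A i := - (k i).2; pose B i := (k i).1 + (k i).2 ^+ 2 / 2.
have Pinj i j : X i = X j -> Y i = Y j -> i = j.
  rewrite /X /Y => h1 h2; apply: kinj.
  rewrite [k i]surjective_pairing [k j]surjective_pairing.
  by rewrite h1 in h2 *; move/addIr: h2 => ->.
have Linj i j : A i = A j -> B i = B j -> i = j.
  rewrite /A /B => /oppr_inj h1 h2; apply: kinj.
  rewrite [k i]surjective_pairing [k j]surjective_pairing.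
  by rewrite h1 in h2 *; move/addIr: h2 => ->.
pose I := incidences X Y A B.
pose sw (p : T * T) := (p.2, p.1).
(* Symmetrised because the unit-area relation may hold in either order of the two lines. *)
pose J := I :|: (sw @: I)%SET.
have cT : (#|{: T}| <= n)%N by rewrite card_sig -[leqRHS]card_ord max_card.
have cJ : (#|J| <= 2 * #|I|)%N.
  by rewrite (leq_trans (leq_card_setU _ _)) // mul2n -addnn leq_add2l leq_imset_card.
have cI := szemeredi_trotter Pinj Linj q.
(* [set0] is a dummy for pairs that form no triangle; for the others the vertices, hence the value,
   are unique. *)
pose Tri (p : T * T) := xget set0 [set Z | exists P Q S,
  triangle_vertices l0 (f (val p.1)) (f (val p.2)) P Q S /\ Z = triangle P Q S].
have S1 (x y : point R) : [set x] = [set y] -> x = y.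
  by move=> E; have : [set y] x by rewrite -E.
have TriE (p : T * T) P Q S : triangle_vertices l0 (f (val p.1)) (f (val p.2)) P Q S ->
    Tri p = triangle P Q S.
  move=> tv; rewrite /Tri; case: xgetP => [Z _ [P' [Q' [S' [tv' ->]]]]|].
    case: tv => E1 E2 E3 _; case: tv'; rewrite E1 E2 E3.
    by move=> /S1 -> /S1 -> /S1 -> _.
  by move=> /(_ (triangle P Q S)) []; exists P, Q, S.
have sub : unit_area_triangles l0 L `<=` Tri @` [set p | p \in J].
  move=> Z [l1 [l2 [L1 L2 [P [Q [S [tv -> ar]]]]]]].
  have [i iI fi] := fsurj _ L1; have [j jI fj] := fsurj _ L2.
  rewrite -{}fi -{}fj in L1 L2 tv *; case: (tv) => _ tvQ tvS _.
  have gi : `[< exists k, f i = slanted a b c k >].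
    by apply/asboolP; apply: (slanted_of_meet ab (Lline _ L1)); rewrite setIC; exact: tvS.
  have gj : `[< exists k, f j = slanted a b c k >].
    by apply/asboolP; apply: (slanted_of_meet ab (Lline _ L2)); exact: tvQ.
  pose i' : T := exist _ (Ordinal iI) gi; pose j' : T := exist _ (Ordinal jI) gj.
  exists (i', j'); last exact: TriE.
  have := @unit_area_slanted _ _ _ c ab (k i') (k j') P Q S.
  rewrite -!fk => /(_ tv ar) [] E /=; rewrite !inE.
    apply/orP; left; rewrite /inc /X /Y /A /B /=; apply/eqP; lra.
  apply/orP; right; apply/imsetP; exists (j', i') => //.
  rewrite inE /inc /X /Y /A /B /=; apply/eqP; lra.
have [m mJ Am] := subset_image_finset_card sub.
exists m => //.
have {mJ} mI := leq_trans mJ cJ.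
apply: leq_trans (leq_mul mI (leqnn _)) _; rewrite -mulnA leq_mul2l /=.
apply: leq_trans cI _.
by rewrite !leq_add ?leq_mul ?leq_exp2r.
Qed.

(** * Lower bound: a box of lines *)

Section LowerBound.
Variable R : realType.

Definition axis : set (point R) := [set p | 0 * p.1 + 1 * p.2 = 0].
Definition graph_line (al be : R) : set (point R) :=
  [set p | 1 * p.1 + (- al) * p.2 = be].

Definition unit_triangle (al be de : R) : set (point R) :=
  triangle (be - al * (2 / de), - (2 / de)) (be + de, 0) (be, 0).

Lemma graph_line_inj al be al' be' :
  graph_line al be = graph_line al' be' -> al = al' /\ be = be'.
Proof.
move=> E.
have h1 : graph_line al' be' (be, 0) by rewrite -E /graph_line /=; lra.
have h2 : graph_line al' be' (al + be, 1) by rewrite -E /graph_line /=; lra.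
by move: h1 h2; rewrite /graph_line /=; lra.
Qed.

Lemma graph_lines_form_unit_triangle al be de : 0 < de ->
  exists p q r, [/\ triangle_vertices axis (graph_line al be)
      (graph_line (al + de ^+ 2 / 2) (be + de)) p q r,
    unit_triangle al be de = triangle p q r & triangle_area p q r = 1].
Proof.
move=> d0; have dN0 : de != 0 by rewrite gt_eqF.
exists (be - al * (2 / de), - (2 / de)), (be + de, 0), (be, 0); split=> //.
- split.
  + apply/seteqP; split=> -[x y]; rewrite /graph_line /=.
      move=> [h1 h2]; have hy : y * (de ^+ 2 / 2) = - de by lra.
      have Ey : y = - (2 / de).
        have -> : y = (y * (de ^+ 2 / 2)) * (2 / de ^+ 2) by field.
        by rewrite hy; field.
      by subst y; congr pair; lra.
    by case=> -> ->; split; field.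
  + apply/seteqP; split=> -[x y]; rewrite /graph_line /axis /=.
      by move=> [h1 h2]; have y0 : y = 0 by [lra]; congr pair => //; subst y; lra.
    by case=> -> ->; split; ring.
  + apply/seteqP; split=> -[x y]; rewrite /graph_line /axis /=.
      by move=> [h1 h2]; have y0 : y = 0 by [lra]; congr pair => //; subst y; lra.
    by case=> -> ->; split; ring.
  + apply/eqP => -[_] /eqP; rewrite oppr_eq0 mulf_eq0 invr_eq0 (negbTE dN0).
    by rewrite pnatr_eq0.
- rewrite /triangle_area /= (_ : _ - _ = 2); first by rewrite gtr0_norm // divff.
  by field.
Qed.

Lemma unit_triangle_base al be de x : 0 < de ->
  unit_triangle al be de (x, 0) -> be <= x <= be + de.
Proof.
move=> d0 [s [t [u [[s0 t0 u0] stu /= hx hy]]]].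
have h : 0 < 2 / de by rewrite divr_gt0.
have sz : s = 0.
  have : s * (2 / de) = 0 by lra.
  by move/eqP; rewrite mulf_eq0 (gt_eqF h) orbF => /eqP.
subst s; have tu : u = 1 - t by lra.
subst u; have td : 0 <= t * de by rewrite mulr_ge0 // ltW.
have td' : 0 <= (1 - t) * de by rewrite mulr_ge0 // ltW.
by apply/andP; split; lra.
Qed.

(** The part on the axis is the base, which recovers [be] and [de]; the apex is the only point at
    depth [2 / de], which recovers [al]. As triangles are counted as sets, distinct parameters then
    count separately. *)
Lemma unit_triangle_inj al be de al' be' de' : 0 < de -> 0 < de' ->
  unit_triangle al be de = unit_triangle al' be' de' ->
  [/\ al = al', be = be' & de = de'].
Proof.
move=> d0 d0' E.
have vl a b d : unit_triangle a b d (b, 0).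
  by exists 0, 0, 1; split=> //=; try lra; rewrite !lexx ler01.
have vr a b d : unit_triangle a b d (b + d, 0).
  by exists 0, 1, 0; split=> //=; try lra; rewrite !lexx ler01.
have va a b d : unit_triangle a b d (b - a * (2 / d), - (2 / d)).
  by exists 1, 0, 0; split=> //=; try lra; rewrite !lexx ler01.
have := vl al be de; rewrite E => /(unit_triangle_base d0') h1.
have := vl al' be' de'; rewrite -E => /(unit_triangle_base d0) h2.
have := vr al be de; rewrite E => /(unit_triangle_base d0') h3.
have := vr al' be' de'; rewrite -E => /(unit_triangle_base d0) h4.
have be_eq : be = be' by lra.
have de_eq : de = de' by lra.
subst be' de'; split=> //.
have := va al be de; rewrite E => -[s [t [u [[s0 t0 u0] stu /= hx hy]]]].
have h : 0 < 2 / de by rewrite divr_gt0.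
have sz : s = 1.
  have : (s - 1) * (2 / de) = 0 by lra.
  by move/eqP; rewrite mulf_eq0 (gt_eqF h) orbF subr_eq0 => /eqP.
have tz : t = 0 by lra.
have uz : u = 0 by lra.
subst s t u; have : (al - al') * (2 / de) = 0 by lra.
by move/eqP; rewrite mulf_eq0 (gt_eqF h) orbF subr_eq0 => /eqP.
Qed.

(* Line number [k] has slope [(k %/ 2K) / 2] and foot [k %% 2K] on the axis,
   so the lines fill a box of side [2K] in the feet and [n / 2K] in twice the
   slopes, matching the quadratic unit area condition. *)
Definition box_line (K k : nat) : set (point R) :=
  graph_line ((k %/ (2 * K))%:R / 2) (k %% (2 * K))%:R.

Definition box_lines (K n : nat) : set (set (point R)) := box_line K @` `I_n.

(** This covers [K = 0] too, where [k %/ 0 = 0] and [k %% 0 = k]. *)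
Lemma box_lines_card K n : (box_lines K n #= `I_n)%card.
Proof.
apply: inj_card_eq => i j _ _ /graph_line_inj[h1 h2].
have {}h1 : (i %/ (2 * K))%:R = (j %/ (2 * K))%:R :> R by lra.
move/eqP: h1; move/eqP: h2; rewrite !eqr_nat => /eqP h2 /eqP h1.
by rewrite (divn_eq i (2 * K)) (divn_eq j (2 * K)) h1 h2.
Qed.

Lemma box_lines_unit_triangles K n m : (10 * K ^ 3 <= n)%N ->
  (unit_area_triangles axis (box_lines K n) #= `I_m)%card -> (K ^ 4 <= m)%N.
Proof.
move=> Kn Um.
(* The feet [B < K] and [K + C] lie in opposite halves of the box, so their difference [de] is
   positive and below [2 * K]. *)
pose J := ('I_(K ^ 2) * 'I_K * 'I_K)%type.
pose de (j : J) : R := (K + j.2 - j.1.2)%N%:R.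
have de0 j : 0 < de j.
  by rewrite ltr0n subn_gt0 (leq_trans (ltn_ord j.1.2)) // leq_addr.
pose f (j : J) := unit_triangle (j.1.1%:R / 2) j.1.2%:R (de j).
have finj : injective f.
  move=> [[A B] C] [[A' B'] C'] /(unit_triangle_inj (de0 _) (de0 _)) /= [h1 h2 h3].
  have {}h1 : A%:R = A'%:R :> R by lra.
  move/eqP: h1; move/eqP: h2; move/eqP: h3; rewrite !eqr_nat /=.
  have := ltn_ord B; have := ltn_ord B'.
  move=> ? ? /eqP h3 /eqP h2 /eqP h1; congr (_, _, _); apply: val_inj => //=.
  by move: h3; rewrite h2; lia.
have fU j : unit_area_triangles axis (box_lines K n) (f j).
  case: j => -[A B] C.
  have HA := ltn_ord A; have HB := ltn_ord B; have HC := ltn_ord C.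
  have [p [q [r [h1 h2 h3]]]] := graph_lines_form_unit_triangle (A%:R / 2) B%:R (de0 (A, B, C)).
  pose D := (K + C - B)%N.
  have HD : (D < 2 * K)%N by rewrite /D; lia.
  have K0 : (0 < 2 * K)%N by lia.
  (* Twice the slopes stay below [5 * K ^ 2] and the feet below [2 * K], so both line numbers are
     below [10 * K ^ 3]. *)
  have HD2 : (A + D ^ 2 < 5 * K ^ 2)%N by nia.
  have modE x y : (y < 2 * K)%N ->
    ((x * (2 * K) + y) %/ (2 * K) = x)%N * ((x * (2 * K) + y) %% (2 * K) = y)%N.
    by move=> yK; rewrite divnMDl // divn_small // addn0 modnMDl modn_small.
  exists (box_line K (A * (2 * K) + B)), (box_line K ((A + D ^ 2) * (2 * K) + (K + C))).
  split.
  - by exists (A * (2 * K) + B)%N => //=; nia.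
  - by exists ((A + D ^ 2) * (2 * K) + (K + C))%N => //=; nia.
  exists p, q, r; split=> //.
  rewrite /box_line !modE; [|lia|lia|lia|lia].
  move: h1; rewrite /de /= -/D natrD natrX mulrDl.
  suff -> : (K + C)%:R = B%:R + D%:R :> R by [].
  by rewrite -natrD /D; congr _%:R; lia.
have cJ : #|{: J}| = (K ^ 4)%N by rewrite !card_prod !card_ord -mulnA mulnn -expnD.
rewrite -card_le_II -cJ -(card_le_eqr Um).
rewrite (card_le_eql card_II).
have inj : {in [set: 'I_#|{: J}|] &, injective (f \o enum_val)}.
  by move=> x y _ _ /finj /enum_val_inj.
rewrite -(card_le_eql (inj_card_eq inj)).
by apply: subset_card_le => _ [x _ <-]; exact: fU.
Qed.

End LowerBound.

(** * Existence and growth of the maximum *)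

Lemma attainable_number_le (R : realType) n m q : attainable_number R n m ->
  (m * q.+1 ^ 2 <= 2 * (n * q.+1 ^ 2 + 3 * n * q.+1 ^ 3 + n ^ 2))%N.
Proof.
move=> [l [L [ll LL Ln Um]]].
have [k kle Uk] := unit_area_triangles_card q ll LL Ln.
suff -> : m = k by [].
by apply/card_eq_II/(card_eq_trans _ Uk); rewrite card_eq_sym.
Qed.

Lemma attainable_number_ge (R : realType) n K : (10 * K ^ 3 <= n)%N ->
  exists2 m, attainable_number R n m & (K ^ 4 <= m)%N.
Proof.
move=> Kn.
have laxis : is_line (@axis R).
  by exists 0, 1, 0; split=> //; apply/eqP => -[] /eqP; rewrite oner_eq0.
have lbox : (@box_lines R K n) `<=` @is_line R.
  move=> _ [k _ <-]; exists 1, (- ((k %/ (2 * K))%:R / 2)), (k %% (2 * K))%:R.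
  by split=> //; apply/eqP => -[] /eqP; rewrite oner_eq0.
have cbox := box_lines_card R K n.
(* The upper bound supplies finiteness, hence an exact count [m]. *)
have [m _ Um] := unit_area_triangles_card 0 laxis lbox cbox.
exists m; first by exists (@axis R), (@box_lines R K n).
exact: box_lines_unit_triangles Kn Um.
Qed.

Lemma ex_max_number (R : realType) n : exists m, is_max_number R n m.
Proof.
pose P m := `[< attainable_number R n m >].
have exP : exists m, P m.
  have [m h _] := @attainable_number_ge R n 0 isT.
  by exists m; apply/asboolP.
have ubP m : P m -> (m <= 2 * (n + 3 * n + n ^ 2))%N.
  by move=> /asboolP/(attainable_number_le 0); rewrite !exp1n !muln1.
case: (ex_maxnP exP ubP) => m /asboolP h hm; exists m; split=> // k hk.
by apply: hm; apply/asboolP.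
Qed.

Theorem theorem5 (R : realType) :
  exists g : nat -> nat,
    (forall n : nat, is_max_number R n (g n)) /\
    (fun n : nat => (g n)%:R : R)
      \is 'Theta_\oo (fun n : nat => n%:R `^ (4 / 3) : R).
Proof.
have /choice[g gmax] := @ex_max_number R.
exists g; split=> //; rewrite qualifE; apply/asboolP.
(* With [x] the cube root of [n], [6 ^- 4] comes from [x / 6 <= K], and [16 = 2 * (1 + 3 * 2 + 1)]
   from [h1], [h2] and [h3]. *)
exists (6 ^- 4, 16) => /=; first by rewrite invr_gt0 exprn_gt0 ?ltr0n.
near=> n.
(* As [216 = 6 ^ 3], this gives [6 <= x], so rounding [x / 3] down keeps at least [x / 6]. *)
have n216 : (216 <= n)%N by near: n; exact: nbhs_infty_ge.
rewrite (ger0_norm (powR_ge0 _ _)) ger0_norm //.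
set x : R := n%:R `^ (1 / 3); have x0 : 0 <= x by exact: powR_ge0.
have xn : x ^+ 3 = n%:R.
  by rewrite -powR_mulrn // -powRrM mul1r mulVf ?powRr1 // pnatr_eq0.
have -> : n%:R `^ (4 / 3) = x ^+ 4.
  by rewrite -powR_mulrn // -powRrM; congr (_ `^ _); field.
have x6 : 6 <= x.
  rewrite -(@ler_pXn2r _ 3) ?nnegrE // xn -natrX ler_nat.
  exact: n216.
have [att ub] := gmax n; split.
- have x30 : 0 <= x / 3 by rewrite divr_ge0.
  have /andP[] := truncn_itv x30; set K := Num.truncn _ => K1 K2.
  have Kx : x / 6 <= K%:R by move: K2; rewrite -[K.+1%:R]natr1; lra.
  have Kn : (10 * K ^ 3 <= n)%N.
    rewrite -(@ler_nat R) natrM natrX -xn.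
    have : K%:R ^+ 3 <= (x / 3) ^+ 3 by rewrite lerXn2r ?nnegrE.
    have : 0 <= x ^+ 3 by rewrite exprn_ge0.
    by rewrite exprMn; lra.
  have [m am Km] := attainable_number_ge R Kn.
  apply: (@le_trans _ _ ((K ^ 4)%N%:R)); last by rewrite ler_nat (leq_trans Km) ?ub.
  rewrite natrX mulrC -exprVn -exprMn lerXn2r ?nnegrE //.
  by rewrite divr_ge0.
(* This choice puts [Q = q.+1] between [x] and [2 * x]. *)
- have /andP[] := truncn_itv x0; set q := Num.truncn _ => q1 q2.
  have := attainable_number_le q att.
  rewrite -(@ler_nat R) !(natrM, natrD, natrX) -xn.
  set Q := q.+1%:R in q2 *; have Q2 : Q <= 2 * x by rewrite /Q -natr1; lra.
  have Q0 : 0 < Q by rewrite ltr0n.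
  move=> H; rewrite -(ler_pM2r (exprn_gt0 2 Q0)); apply: le_trans H _.
  have x3 : 0 <= x ^+ 3 by rewrite exprn_ge0.
  have h1 : x ^+ 3 * Q ^+ 2 <= x ^+ 4 * Q ^+ 2.
    by rewrite ler_wpM2r ?sqr_ge0 // [x ^+ 4]exprSr ler_peMr //; lra.
  have h2 : x ^+ 3 * Q ^+ 3 <= 2 * (x ^+ 4 * Q ^+ 2).
    have -> : 2 * (x ^+ 4 * Q ^+ 2) = x ^+ 3 * Q ^+ 2 * (2 * x) by ring.
    have -> : x ^+ 3 * Q ^+ 3 = x ^+ 3 * Q ^+ 2 * Q by ring.
    by rewrite ler_wpM2l // mulr_ge0 ?sqr_ge0 //.
  have h3 : x ^+ 3 ^+ 2 <= x ^+ 4 * Q ^+ 2.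
    have -> : x ^+ 3 ^+ 2 = x ^+ 4 * x ^+ 2 by ring.
    by rewrite ler_wpM2l ?exprn_ge0 // lerXn2r ?nnegrE // ltW.
  by lra.
Unshelve. all: by end_near. Qed.
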